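(* Let $(R,\mathcal{M})$ be a commutative local ring such that every ideal of $R$ is a direct sum of cyclic $R$-modules. Then $\dim(R)\le 1$, $|\mathrm{Spec}(R)|\le 3$, and there are an index set $\Lambda$ and elements $x,y\in R$ and $w_\lambda\in R$ ($\lambda\in\Lambda$) such that $\mathcal{M}=Rx\oplus Ry\oplus\left(\bigoplus_{\lambda\in\Lambda}Rw_\lambda\right)$ with each $Rw_\lambda$ a simple $R$-module. Moreover: (a) If $x,y\in\mathrm{Nil}(R)$, then $\mathrm{Spec}(R)=\{\mathcal{M}\}$. (b) If $\mathcal{M}=Rz$ with $z\notin\mathrm{Nil}(R)$, then $\mathrm{Spec}(R)=\{(0),\mathcal{M}\}$. (c) If $\mathcal{M}$ is not cyclic, $x\notin\mathrm{Nil}(R)$ and $y\in\mathrm{Nil}(R)$, then $\mathrm{Spec}(R)=\{\mathcal{M},\ Ry\oplus(\bigoplus_{\lambda\in\Lambda}Rw_\lambda)\}$. (d) If $\mathcal{M}$ is not cyclic, $x\in\mathrm{Nil}(R)$ and $y\notin\mathrm{Nil}(R)$, then $\mathrm{Spec}(R)=\{\mathcal{M},\ Rx\oplus(\bigoplus_{\lambda\in\Lambda}Rw_\lambda)\}$. (e) If $\mathcal{M}$ is not cyclic and $x,y\notin\mathrm{Nil}(R)$, then $\mathrm{Spec}(R)=\{\mathcal{M},\ Rx\oplus(\bigoplus_{\lambda\in\Lambda}Rw_\lambda),\ Ry\oplus(\bigoplus_{\lambda\in\Lambda}Rw_\lambda)\}$.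
   Context: All rings are commutative with identity and all modules are unital. A ring is local if it has a unique maximal ideal (no Noetherian assumption); $(R,\mathcal{M})$ denotes a local ring with maximal ideal $\mathcal{M}$. $\mathrm{Spec}(R)$ is the set of prime ideals of $R$, $\mathrm{Nil}(R)$ is the ideal of all nilpotent elements of $R$, and $\dim(R)$ is the classical Krull dimension. A module is simple if it is nonzero and has no submodules except $(0)$ and itself. Direct sums of ideals contained in $R$ are internal. Index sets may be empty, and the elements $x,y$ may be zero. *)

(* Defs.v *)
From mathcomp Require Import all_boot all_order all_algebra ring_quotient.
From mathcomp Require Import boolp classical_sets functions cardinality.

Set Implicit Arguments.
Unset Strict Implicit.
Unset Printing Implicit Defensive.

Import GRing.Theory.
Local Open Scope classical_set_scope.
Local Open Scope ring_scope.

(* [ring_quotient] only has decidable proper ideals [{pred R}]; here ideals are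
   classical sets, with the unit ideal allowed, so that the submodules of [R^o]
   are exactly the ideals. *)
Definition is_ideal (R : comNzRingType) (I : set R) : Prop :=
  submod_closed ([in I] : {pred R^o}).

(* [idealr_closed] includes [1 \notin P]. *)
Definition is_prime (R : comNzRingType) (P : set R) : Prop :=
  idealr_closed [in P] /\ prime_idealr_closed [in P].

Definition is_maximal (R : comNzRingType) (M : set R) : Prop :=
  [/\ is_ideal M, M <> setT &
      forall J : set R, is_ideal J -> M `<=` J -> J = M \/ J = setT].

Definition is_local (R : comNzRingType) (M : set R) : Prop :=
  is_maximal M /\ forall N : set R, is_maximal N -> N = M.

Definition Spec (R : comNzRingType) : set (set R) := [set P | is_prime P].
Arguments Spec : clear implicits.

Definition Nilrad (R : comNzRingType) : set R :=
  [set r | exists n : nat, r ^+ n = 0].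
Arguments Nilrad : clear implicits.

(* Every strictly increasing chain of k + 1 primes has k <= n. *)
Definition krull_dim_le (R : comNzRingType) (n : nat) : Prop :=
  forall (k : nat) (P : nat -> set R),
    (forall i, (i <= k)%N -> is_prime (P i)) ->
    (forall i, (i < k)%N -> P i `<` P i.+1) ->
    (k <= n)%N.

Definition principal (R : comNzRingType) (a : R) : set R :=
  [set r * a | r in [set: R]].

(* The submodules of an ideal [I] are the ideals contained in [I]. *)
Definition is_simple (R : comNzRingType) (I : set R) : Prop :=
  [/\ is_ideal I, I <> [set 0] &
      forall J : set R, is_ideal J -> J `<=` I -> J = [set 0] \/ J = I].

(* The sum of the ideals [J l], [l] in [D]: all finite sums of elements of
   these ideals, and [[set 0]] if [D] is empty. *)
Definition ideal_sum (R : comNzRingType) (L : Type) (D : set L)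
    (J : L -> set R) : set R :=
  [set r | exists (n : nat) (l : 'I_n -> L) (f : 'I_n -> R),
     (forall k, D (l k) /\ J (l k) (f k)) /\ r = \sum_(k < n) f k].

(* [I] is the internal direct sum of the ideals [J l]. *)
Definition is_direct_sum (R : comNzRingType) (L : Type) (I : set R)
    (J : L -> set R) : Prop :=
  I = ideal_sum setT J /\
  forall l : L, J l `&` ideal_sum (~` [set l]) J = [set 0].

Definition is_sum_of_cyclics (R : comNzRingType) (I : set R) : Prop :=
  exists (L : Type) (a : L -> R), is_direct_sum I (fun l => principal (a l)).

(* [oapp w y : option L -> R] is the family [w] extended by [y] at [None], so
   the family of ideals below consists of Rx, Ry and the Rw_l. *)
Definition is_decomposition (R : comNzRingType) (L : Type) (M : set R)
    (x y : R) (w : L -> R) : Prop :=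
  is_direct_sum M (fun l => principal (oapp (oapp w y) x l)) /\
  forall l : L, is_simple (principal (w l)).

(* Ry + sum of the Rw_l *)
Definition partial_sum (R : comNzRingType) (L : Type) (y : R) (w : L -> R) :
    set R :=
  ideal_sum setT (fun l => principal (oapp w y l)).

(* Main.v *)
(* If [M = Rx + N] is a direct sum with [x] not nilpotent, then [x N = 0], and the
   intersection of the ideals [R x ^+ n], being a direct sum of cyclic modules
   that equals [x] times itself, is zero by Nakayama. So the nonzero elements of
   [Rx] are the unit multiples of powers of [x]; hence [N] is prime, and it is
   the only prime not containing [x]. In a decomposition of [M] into cyclics
   [R a_l], the summand is simple or zero as soon as [a_l ^+ 2 = 0], and at most
   two of the [a_l] have nonzero square. *)
Require Import Defs.
From mathcomp Require Import all_boot all_order all_algebra.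
From mathcomp Require Import boolp classical_sets functions cardinality.
From mathcomp Require Import ring.

Local Open Scope classical_set_scope.
Local Open Scope card_scope.
Local Open Scope ring_scope.

Import GRing.Theory.

(** * Ideals, primes and sums of ideals in terms of elements *)

Lemma is_idealP (R : comNzRingType) (I : set R) :
  is_ideal I <-> I 0 /\ forall a u v, I u -> I v -> I (a * u + v).
Proof.
split=> [[I0 IMD]|[I0 IMD]].
  split=> [|a u v Iu Iv]; first by rewrite inE in I0.
  by have := IMD a u v; rewrite !inE; apply.
split=> [|a u v]; first by rewrite inE.
by rewrite !inE => Iu Iv; apply: IMD.
Qed.

Lemma is_primeP (R : comNzRingType) (P : set R) :
  is_prime P <->
  [/\ is_ideal P, ~ P 1 & forall u v, P (u * v) -> P u \/ P v].
Proof.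
split=> [[[P0 P1 PMD] PM]|[/is_idealP[P0 PMD] P1 PM]].
  split; first by split.
  - by move=> ?; move: P1; rewrite notin_setE; apply.
  - move=> u v Puv; have := PM u v; rewrite !inE.
    by move=> /(_ Puv)/orP[]; rewrite inE; [left|right].
split; first split; rewrite ?inE ?notin_setE //.
  by move=> a u v; rewrite !inE; apply: PMD.
move=> u v; rewrite !inE => /PM[] ?; apply/orP; [left|right]; exact/mem_set.
Qed.

Lemma ideal0 (R : comNzRingType) (I : set R) : is_ideal I -> I 0.
Proof. by case/is_idealP. Qed.

Lemma idealM (R : comNzRingType) (I : set R) a u :
  is_ideal I -> I u -> I (a * u).
Proof. by case/is_idealP=> I0 h Iu; rewrite -[a * u]addr0; apply: h. Qed.

Lemma idealD (R : comNzRingType) (I : set R) u v :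
  is_ideal I -> I u -> I v -> I (u + v).
Proof. by case/is_idealP=> I0 h Iu Iv; rewrite -[u]mul1r; apply: h. Qed.

Lemma idealB (R : comNzRingType) (I : set R) u v :
  is_ideal I -> I u -> I v -> I (u - v).
Proof.
by move=> hI Iu Iv; apply: idealD => //; rewrite -mulN1r; apply: idealM.
Qed.

Lemma ideal_set0 (R : comNzRingType) : is_ideal [set (0 : R)].
Proof. by apply/is_idealP; split=> // a u v /= -> ->; rewrite mulr0 addr0. Qed.

Lemma principal_ideal (R : comNzRingType) (a : R) : is_ideal (principal a).
Proof.
apply/is_idealP; split; first by exists 0; rewrite ?mul0r.
by move=> r _ _ [s _ <-] [t _ <-]; exists (r * s + t) => //; ring.
Qed.

Lemma mem_principal (R : comNzRingType) (a : R) : principal a a.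
Proof. by exists 1; rewrite ?mul1r. Qed.

Lemma principalM (R : comNzRingType) (a r : R) : principal a (r * a).
Proof. by exists r. Qed.

Lemma principal_sub (R : comNzRingType) (I : set R) a :
  is_ideal I -> I a -> principal a `<=` I.
Proof. by move=> hI Ia _ [r _ <-]; apply: idealM. Qed.

Lemma ideal_sumS (R : comNzRingType) (L : Type) (D : set L) (J : L -> set R)
    (K : set R) :
  is_ideal K -> (forall l, D l -> J l `<=` K) -> ideal_sum D J `<=` K.
Proof.
move=> hK JK _ [n [l [f [Jf ->]]]].
elim/big_ind : _ => [|u v|k _]; [exact: ideal0|exact: idealD|].
by have [Dl] := Jf k; apply: JK.
Qed.

Lemma sub_ideal_sum (R : comNzRingType) (L : Type) (D : set L) (J : L -> set R)
    l : D l -> J l `<=` ideal_sum D J.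
Proof.
move=> Dl r Jr; exists 1%N, (fun=> l), (fun=> r).
by rewrite big_ord_recl big_ord0 addr0.
Qed.

Lemma ideal_sum_ideal (R : comNzRingType) (L : Type) (D : set L)
    (J : L -> set R) : (forall l, is_ideal (J l)) -> is_ideal (ideal_sum D J).
Proof.
move=> hJ; apply/is_idealP; split.
  exists 0%N, (fun k : 'I_0 => False_rect L (notF (ltn_ord k))), (fun=> 0).
  by split; [case|rewrite big_ord0].
move=> a _ _ [n [l [f [Jf ->]]]] [m [l' [f' [Jf' ->]]]].
exists (n + m)%N.
exists (fun k => match fintype.split k with inl i => l i | inr j => l' j end).
exists (fun k =>
  match fintype.split k with inl i => a * f i | inr j => f' j end).
split=> [k|].
  by case: splitP => i _; [case: (Jf i) => ? ?; split=> //; exact: idealM|].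
rewrite big_split_ord mulr_sumr; congr (_ + _).
  by apply: eq_bigr => i _; rewrite (unsplitK (inl i)).
by apply: eq_bigr => i _; rewrite (unsplitK (inr i)).
Qed.

(** * Units and Nakayama in a local ring *)

(** If [r] had no inverse, Zorn's lemma would give a maximal ideal containing [r], and locality
    identifies that ideal with [M]. *)
Lemma not_mem_maximal_unit (R : comNzRingType) (M : set R) (r : R) :
  is_local M -> ~ M r -> exists s, s * r = 1.
Proof.
move=> [_ hM] Mr; apply: contrapT => r_nunit; apply: Mr.
(* [set0] is admitted so that the empty chain has a bound. *)
pose good (A : set R) := A = set0 \/ [/\ is_ideal A, A r & ~ A 1].
have good_principal : good (principal r).
  right; split; [exact: principal_ideal|exact: mem_principal|].
  by move=> [s _ sr]; apply: r_nunit; exists s.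
have [|N [gN Nmax]] := @Zorn_bigcup R good.
  move=> F Fgood Ftot.
  have [F0|] := pselect (forall X, F X -> X = set0).
    by left; apply/seteqP; split=> // z [X FX]; rewrite (F0 _ FX).
  move=> /existsNP[X0 /not_implyP[FX0 X0n0]].
  have inF X z : F X -> X z -> [/\ is_ideal X, X r & ~ X 1].
    by move=> FX Xz; case: (Fgood _ FX) => // X00; move: Xz; rewrite X00.
  have [/(X0n0)//|[hX0 X0r _]] := Fgood _ FX0.
  right; split; first 1 last.
  - by exists X0.
  - by move=> [X FX X1]; have [_ _] := inF _ _ FX X1; apply.
  apply/is_idealP; split; first by exists X0 => //; exact: ideal0.
  move=> a u v [X FX Xu] [Y FY Yv].
  have [hX _ _] := inF _ _ FX Xu; have [hY _ _] := inF _ _ FY Yv.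
  have [XY|YX] := Ftot _ _ FX FY.
    by exists Y => //; apply: idealD => //; apply: idealM => //; apply: XY.
  by exists X => //; apply: idealD => //; [exact: idealM|exact: YX].
case: gN => [N0|[hN Nr N1]].
  exfalso; apply: (Nmax (principal r)) => //.
  by rewrite N0; split=> // /(_ _ (mem_principal _ r)).
rewrite -(hM N) //; split=> //; first by move=> NT; apply: N1; rewrite NT.
move=> J hJ NJ; have [J1|J1] := pselect (J 1).
  by right; apply/seteqP; split=> // z _; rewrite -[z]mulr1; apply: idealM.
left; apply/seteqP; split=> //; apply: contrapT => JN.
by apply: (Nmax J) => //; right; split=> //; apply: NJ.
Qed.

Lemma maximal_ideal (R : comNzRingType) (M : set R) : is_local M -> is_ideal M.
Proof. by case=> -[]. Qed.

Lemma maximal_not1 (R : comNzRingType) (M : set R) : is_local M -> ~ M 1.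
Proof.
move=> [[hM MT _] _] M1; apply: MT; apply/seteqP; split=> // z _.
by rewrite -[z]mulr1; apply: idealM.
Qed.

Lemma maximal_prime (R : comNzRingType) (M : set R) : is_local M -> is_prime M.
Proof.
move=> hM; have MI := maximal_ideal _ _ hM.
apply/is_primeP; split=> // [|u v Muv]; first exact: maximal_not1.
have [Mu|Mu] := pselect (M u); [by left|right].
have [s su] := not_mem_maximal_unit _ _ _ hM Mu.
by rewrite -[v]mul1r -su -mulrA; apply: idealM.
Qed.

Lemma prime_sub_maximal (R : comNzRingType) (M P : set R) :
  is_local M -> is_prime P -> P `<=` M.
Proof.
move=> hM /is_primeP[PI P1 _] p Pp; apply: contrapT => Mp; apply: P1.
by have [s <-] := not_mem_maximal_unit _ _ _ hM Mp; apply: idealM.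
Qed.

Lemma prime_exp (R : comNzRingType) (P : set R) (x : R) n :
  is_prime P -> P (x ^+ n) -> P x.
Proof.
move=> /is_primeP[PI P1 PM]; elim: n => [|n IHn] //.
by rewrite exprS => /PM[].
Qed.

Lemma prime_nilpotent (R : comNzRingType) (P : set R) (x : R) :
  is_prime P -> Nilrad R x -> P x.
Proof.
move=> Pp [n xn]; apply: (prime_exp _ _ _ n Pp); rewrite xn.
by apply: ideal0; case/is_primeP: Pp.
Qed.

(** Since [r] lies in [M], the element [1 - r] lies outside [M], so it is a unit, and it kills
    [a]. *)
Lemma nakayama_cyclic (R : comNzRingType) (M : set R) (r a : R) :
  is_local M -> M r -> a = r * a -> a = 0.
Proof.
move=> hM Mr ra; have [|s s1] := not_mem_maximal_unit _ _ (1 - r) hM.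
  move=> M1r; apply: (maximal_not1 _ _ hM); rewrite -(subrK r 1).
  by apply: idealD => //; exact: maximal_ideal.
by rewrite -[a]mul1r -s1 -mulrA mulrBl mul1r -ra subrr mulr0.
Qed.

(** * Complements of a cyclic summand *)

(** Elementwise form of the internal direct sum of [Rx] and [N] being [M]. Here [M] can be any
    ideal: the notion serves for the maximal ideal and for the auxiliary ideals that [hR] splits. *)
Definition is_complement {R : comNzRingType} (M : set R) (x : R) (N : set R) :=
  [/\ is_ideal N, M x, N `<=` M,
      forall m, M m -> exists r n, N n /\ m = r * x + n &
      forall r, N (r * x) -> r * x = 0].

Lemma direct_sum_complement (R : comNzRingType) (L : Type) (I : set R)
    (a : L -> R) l :
  is_direct_sum I (fun l => principal (a l)) ->
  is_complement I (a l) (ideal_sum (~` [set l]) (fun l => principal (a l))).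
Proof.
move=> [-> dir].
have pI k : is_ideal (principal (a k)) by exact: principal_ideal.
have sI D : is_ideal (ideal_sum D (fun l => principal (a l))).
  exact: ideal_sum_ideal.
split=> //.
- by apply: (sub_ideal_sum _ _ _ _ l) => //; exact: mem_principal.
- by apply: ideal_sumS => // k _; apply: (sub_ideal_sum _ _ _ _ k).
- pose K := [set m | exists r n,
    ideal_sum (~` [set l]) (fun l => principal (a l)) n /\ m = r * a l + n].
  apply: (ideal_sumS _ _ _ _ K) => [|k _ _ [r _ <-]].
    apply/is_idealP; split.
      by exists 0, 0; split; [exact: ideal0|rewrite mul0r addr0].
    move=> b _ _ [r [n [Nn ->]]] [r' [n' [Nn' ->]]].
    exists (b * r + r'), (b * n + n'); split; last by ring.
    by apply: idealD => //; apply: idealM.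
  have [->|kl] := pselect (k = l).
    by exists r, 0; rewrite addr0; split=> //; apply: ideal0.
  exists 0, (r * a k); rewrite mul0r add0r; split=> //.
  by apply: (sub_ideal_sum _ _ _ _ k) => //; exact: principalM.
- move=> r Nr; have : (principal (a l) `&`
    ideal_sum (~` [set l]) (fun l => principal (a l))) (r * a l).
    by split=> //; exact: principalM.
  by rewrite dir.
Qed.

(** The product lies in [R (a k)] and in the sum of the other summands, which meet in zero. *)
Lemma direct_sum_mul0 (R : comNzRingType) (L : Type) (I : set R) (a : L -> R)
    l k :
  is_direct_sum I (fun l => principal (a l)) -> l <> k -> a l * a k = 0.
Proof.
move=> dirI lk; have [NI _ _ _ ->//] := direct_sum_complement _ _ _ _ k dirI.
rewrite mulrC; apply: idealM => //.
by apply: (sub_ideal_sum _ _ _ _ l) => //; exact: mem_principal.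
Qed.

(** * Complements of non-nilpotent generators and prime ideals *)

(* If [x ^+ n] is a unit multiple of [x ^+ n.+1], Nakayama kills it; so [Q], the
   intersection of the [R x ^+ n], satisfies [Q = x Q], and the same argument on
   a generator of each cyclic summand of [Q] gives [Q = 0]. *)
Lemma complement_unit_power (R : comNzRingType) (M : set R)
  (hM : is_local M)
  (hR : forall I : set R, is_ideal I -> is_sum_of_cyclics I)
  (x : R) (N : set R) (r : R) :
  is_complement M x N -> ~ Nilrad R x -> r * x <> 0 ->
  exists u v n, v * u = 1 /\ r * x = u * x ^+ n.
Proof.
move=> [NI Mx NM MxN xN0] xnil rx0.
have xN n : N n -> x * n = 0.
  by move=> Nn; rewrite mulrC; apply: xN0; rewrite mulrC; exact: idealM.
pose Q := [set z | forall n, exists s, z = s * x ^+ n.+1].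
have QI : is_ideal Q.
  apply/is_idealP; split=> [n|b u v Qu Qv n]; first by exists 0; rewrite mul0r.
  have [[s ->] [t ->]] := (Qu n, Qv n).
  by exists (b * s + t); ring.
(* Take the least [n] such that [s * x] is not a multiple of [x ^+ n.+1]. Then [s * x = t * x ^+ n],
   and [t] is a unit: if it were in [M], its [N]-part would be killed by [x] and the rest would give
   one more factor [x]. *)
have notQ s : ~ Q (s * x) -> exists u v n, v * u = 1 /\ s * x = u * x ^+ n.
  move=> /existsNP ex; pose p n := `[< ~ exists t, s * x = t * x ^+ n.+1 >].
  have exp : exists n, p n by case: ex => n nQ; exists n; apply/asboolP.
  case: (ex_minnP exp) => -[|n] /asboolP pn minn.
    by case: pn; exists s.
  have [t st] : exists t, s * x = t * x ^+ n.+1.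
    by apply: contrapT => /asboolP/minn; rewrite ltnn.
  have [|v vt] := not_mem_maximal_unit _ _ t hM; last by exists t, v, n.+1.
  move=> /MxN[t' [e [Ne te]]]; apply: pn; exists t'.
  have -> : s * x = t' * x ^+ n.+2 + (x * e) * x ^+ n.
    by rewrite st te !exprS; ring.
  by rewrite xN // mul0r addr0.
apply: (notQ r) => Qrx; apply: rx0.
(* Write [p = s * x ^+ 2]. If [s * x] were outside [Q], [p] would be a unit multiple of some
   [x ^+ n.+1] and also a multiple of [x ^+ n.+2], so [x] would be nilpotent by Nakayama. *)
have QxQ p : Q p -> exists2 q, Q q & p = x * q.
  move=> Qp; have [s ps] := Qp 1%N; exists (s * x); last by rewrite ps; ring.
  apply: contrapT => /notQ[u [v [n [vu sx]]]].
  have [t pt] := Qp n.+1.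
  apply: xnil; exists n.+1; apply: (nakayama_cyclic _ _ (v * t * x) _ hM).
    by apply: idealM => //; exact: maximal_ideal.
  have <- : v * p = v * t * x * x ^+ n.+1 by rewrite pt !exprS; ring.
  have -> : p = u * x ^+ n.+1 by rewrite exprS mulrCA -sx ps; ring.
  by rewrite mulrA vu mul1r.
have [L [q dirQ]] := hR Q QI.
(* With [q l = x * z] and [z = s * q l + e], the element [(1 - x * s) * q l = x * e] lies in the
   summand and in its complement, so it vanishes. *)
have q0 l : q l = 0.
  have [N'I Ql N'Q QlN' ql0] := direct_sum_complement _ _ _ _ l dirQ.
  have [z Qz qlz] := QxQ _ Ql; have [s [e [N'e ze]]] := QlN' _ Qz.
  apply: (nakayama_cyclic _ _ (x * s) _ hM).
    by rewrite mulrC; apply: idealM => //; exact: maximal_ideal.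
  apply/eqP; rewrite -subr_eq0; apply/eqP.
  rewrite -[in LHS](mul1r (q l)) mulrA -mulrBl; apply: ql0.
  have -> : (1 - x * s * 1) * q l = x * e.
    by rewrite mulr1 mulrBl mul1r {1}qlz ze; ring.
  exact: idealM.
case: dirQ => QE _; move: Qrx; rewrite QE.
apply: (ideal_sumS _ _ _ _ [set 0]) => [|l _]; first exact: ideal_set0.
by apply: principal_sub; [exact: ideal_set0|rewrite q0].
Qed.

(** Elements outside [M] are units, and modulo [N] the nonzero elements of [M] are unit multiples of
    powers of [x]. If a product of two of these were in [N], so would be a power of [x], and [x]
    would be nilpotent. *)
Lemma complement_prime (R : comNzRingType) (M : set R)
  (hM : is_local M)
  (hR : forall I : set R, is_ideal I -> is_sum_of_cyclics I)
  (x : R) (N : set R) :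
  is_complement M x N -> ~ Nilrad R x -> is_prime N.
Proof.
move=> cN xnil; have [NI Mx NM MxN xN0] := cN.
have pow r : r * x <> 0 -> exists u v n, v * u = 1 /\ r * x = u * x ^+ n.
  by move=> rx0; apply: complement_unit_power cN xnil rx0.
apply/is_primeP; split=> //; first by move=> /NM; exact: maximal_not1.
have unitP a b : N (a * b) -> ~ M a -> N b.
  move=> Nab Ma; have [s sa] := not_mem_maximal_unit _ _ _ hM Ma.
  by rewrite -[b]mul1r -sa -mulrA; apply: idealM.
move=> a b Nab.
have [Ma|Ma] := pselect (M a); last by right; apply: unitP Ma.
have [Mb|Mb] := pselect (M b); last first.
  by left; apply: unitP Mb; rewrite mulrC.
have [r [n [Nn an]]] := MxN _ Ma; have [s [m [Nm bm]]] := MxN _ Mb.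
have [rx0|/pow[u [v [i [vu rx]]]]] := pselect (r * x = 0).
  by left; rewrite an rx0 add0r.
have [sx0|/pow[u' [v' [j [vu' sx]]]]] := pselect (s * x = 0).
  by right; rewrite bm sx0 add0r.
(* The extra factor [x] makes the power a multiple of [x] even for [i = j = 0], so that [xN0]
   applies. *)
exfalso; apply: xnil; exists (i + j).+1.
rewrite exprSr; apply: xN0; rewrite exprD.
have -> : x ^+ i * x ^+ j * x =
    (v * v' * x) * (a * b - (r * x + n) * m - b * n + n * m).
  have -> : a * b - (r * x + n) * m - b * n + n * m =
      (u * x ^+ i) * (u' * x ^+ j).
    by rewrite an bm -rx -sx; ring.
  have -> : (v * v' * x) * ((u * x ^+ i) * (u' * x ^+ j)) =
     (v * u) * (v' * u') * (x ^+ i * x ^+ j * x) by ring.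
  by rewrite vu vu' !mul1r.
apply: idealM => //; apply: idealD => //; last exact: idealM.
by apply: idealB => //; [apply: idealB => //|]; exact: idealM.
Qed.

(** As [x] kills [N] and [P] omits [x], the prime [P] contains [N]. An element of [P] outside [N]
    would put a unit multiple of a power of [x] in [P]. *)
Lemma prime_eq_complement (R : comNzRingType) (M : set R)
  (hM : is_local M)
  (hR : forall I : set R, is_ideal I -> is_sum_of_cyclics I)
  (x : R) (N P : set R) :
  is_complement M x N -> is_prime P -> ~ P x -> P = N.
Proof.
move=> cN Pp Px; have [NI Mx NM MxN xN0] := cN.
have [PI P1 PM] := (is_primeP _ _).1 Pp.
have NP : N `<=` P.
  move=> n Nn; have /PM[] // : P (n * x).
  have -> : n * x = 0 by apply: xN0; rewrite mulrC; exact: idealM.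
  exact: ideal0.
apply/seteqP; split=> // p Pp'.
have [r [n [Nn pn]]] := MxN _ (prime_sub_maximal _ _ _ hM Pp _ Pp').
have [rx0|rx0] := pselect (r * x = 0); first by rewrite pn rx0 add0r.
have xnil : ~ Nilrad R x by move=> xnil; apply: Px; exact: prime_nilpotent.
have [u [v [i [vu rx]]]] := complement_unit_power _ _ hM hR _ _ _ cN xnil rx0.
case: Px; apply: (prime_exp _ _ _ i Pp).
have -> : x ^+ i = v * (p - n) by rewrite pn addrK rx mulrA vu mul1r.
by apply: idealM => //; apply: idealB => //; apply: NP.
Qed.

(** * At most two summands with nonzero square *)

(* Pairing the coefficient vectors of two distinct summands of the ideal
   [R (x1 + x2) + R (x1 + x3)] gives zero componentwise modulo [M], so at most
   one summand is nonzero modulo [M x1 + M x2 + M x3]; but the two generators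
   are linearly independent there. *)
Lemma no_three_nonsquarezero (R : comNzRingType) (M : set R) (x1 x2 x3 : R)
  (hM : is_local M)
  (hR : forall I : set R, is_ideal I -> is_sum_of_cyclics I)
  (free : forall r1 r2 r3, r1 * x1 + r2 * x2 + r3 * x3 = 0 ->
     [/\ r1 * x1 = 0, r2 * x2 = 0 & r3 * x3 = 0]) :
  x1 * x2 = 0 -> x1 * x3 = 0 -> x2 * x3 = 0 ->
  x1 * x1 <> 0 -> x2 * x2 <> 0 -> x3 * x3 <> 0 -> False.
Proof.
move=> x12 x13 x23 x1n x2n x3n.
have MI := maximal_ideal _ _ hM.
have annM r x : x * x <> 0 -> r * x = 0 -> M r.
  move=> xn rx; apply: contrapT => Mr; apply: xn.
  have [s sr] := not_mem_maximal_unit _ _ _ hM Mr.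
  have -> : x = s * (r * x) by rewrite mulrA sr mul1r.
  by rewrite rx mulr0 mul0r.
have freeM r1 r2 r3 : r1 * x1 + r2 * x2 + r3 * x3 = 0 -> [/\ M r1, M r2 & M r3].
  by move=> /free[/annM ? /annM ? /annM ?]; split; auto.
have MM a b : M (a * b) -> M a \/ M b.
  by have /is_primeP[_ _] := maximal_prime _ _ hM; apply.
have M1 := maximal_not1 _ _ hM.
pose N := [set z | exists m1 m2 m3,
  [/\ M m1, M m2 & M m3] /\ z = m1 * x1 + m2 * x2 + m3 * x3].
have NI : is_ideal N.
  apply/is_idealP; split.
    by exists 0, 0, 0; split; [split; exact: ideal0|rewrite !mul0r !addr0].
  move=> a _ _ [m1 [m2 [m3 [[h1 h2 h3] ->]]]] [k1 [k2 [k3 [[l1 l2 l3] ->]]]].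
  exists (a * m1 + k1), (a * m2 + k2), (a * m3 + k3); split; last by ring.
  by split; apply: idealD => //; apply: idealM.
(* Modulo [N] the three generators are linearly independent over the residue field. *)
have coefN r1 r2 r3 : N (r1 * x1 + r2 * x2 + r3 * x3) -> [/\ M r1, M r2 & M r3].
  move=> [m1 [m2 [m3 [[h1 h2 h3] E]]]].
  have [|g1 g2 g3] := freeM (r1 - m1) (r2 - m2) (r3 - m3).
    by rewrite !mulrBl; move/eqP: E; rewrite -subr_eq0 => /eqP <-; ring.
  by rewrite -(subrK m1 r1) -(subrK m2 r2) -(subrK m3 r3); split; apply: idealD.
pose u := x1 + x2; pose v := x1 + x3.
pose I := [set z | exists r s, z = r * u + s * v].
have II : is_ideal I.
  apply/is_idealP; split; first by exists 0, 0; rewrite !mul0r addr0.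
  move=> a _ _ [r [s ->]] [r' [s' ->]].
  by exists (a * r + r'), (a * s + s'); ring.
have Iu : I u by exists 1, 0; rewrite mul1r mul0r addr0.
have Iv : I v by exists 0, 1; rewrite mul1r mul0r add0r.
have [L [a dirI]] := hR I II.
(* With respect to [x1], [x2], [x3], the element [r * u + s * v] has coordinates [r + s], [r],
   [s]. *)
have Ia l : exists r s, a l = (r + s) * x1 + r * x2 + s * x3.
  have [_ [r [s ->]] _ _ _] := direct_sum_complement _ _ _ _ l dirI.
  by exists r, s; rewrite /u /v; ring.
have IE K : is_ideal K -> (forall l, K (a l)) -> I `<=` K.
  move=> hK Ka; case: dirI => -> _; apply: ideal_sumS => // l _.
  exact: principal_sub.
have [aN|/existsNP[l aN]] := pselect (forall l, N (a l)).
  have : N (1 * x1 + 1 * x2 + 0 * x3).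
    by rewrite !mul1r mul0r addr0; apply: IE Iu.
  by case/coefN.
have [r [s al]] := Ia l.
(* The product of the two generators is zero and its cross terms vanish, so [free] and the nonzero
   squares put each coordinatewise product in [M]. *)
have others k : k <> l -> N (a k).
  move=> kl; have [r' [s' ak]] := Ia k.
  have : a k * a l = 0 by exact: direct_sum_mul0 dirI kl.
  rewrite ak al => E.
  have sq : ((r' + s') * (r + s) * x1) * x1 + (r' * r * x2) * x2 +
      (s' * s * x3) * x3 = 0.
    transitivity (((r' + s') * x1 + r' * x2 + s' * x3) *
        ((r + s) * x1 + r * x2 + s * x3)
      - (((r' + s') * r + r' * (r + s)) * (x1 * x2) +
         ((r' + s') * s + s' * (r + s)) * (x1 * x3) +
         (r' * s + s' * r) * (x2 * x3))); first by ring.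
    by rewrite E x12 x13 x23 !mulr0 !addr0 subr0.
  have {sq} [sq1 sq2 sq3] := free _ _ _ sq.
  have Msq c x : x * x <> 0 -> c * x * x = 0 -> M c.
    move=> xn cx; apply: contrapT => Mc; apply: xn.
    have [t tc] := not_mem_maximal_unit _ _ _ hM Mc.
    have -> : x * x = t * (c * x * x) by rewrite !mulrA tc mul1r.
    by rewrite cx mulr0.
  have {sq1 sq2 sq3} [M1' M2' M3'] :
      [/\ M ((r' + s') * (r + s)), M (r' * r) & M (s' * s)].
    by split; [exact: Msq sq1|exact: Msq sq2|exact: Msq sq3].
  have Mcross : M (r' * s + s' * r).
    have -> : r' * s + s' * r = (r' + s') * (r + s) - r' * r - s' * s by ring.
    by do 2 apply: idealB => //.
  (* Modulo [M], the relations [r' * r = s' * s = 0] and [r' * s + s' * r = 0] force [r' = s' = 0],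
     because [a l] is outside [N] and so [r] or [s] is nonzero. *)
  have [Mr Ms] : M r' /\ M s'.
    have [Mr|Mr] := pselect (M r).
      have Ms : ~ M s.
        move=> Ms; apply: aN; rewrite al; exists (r + s), r, s.
        by split=> //; split=> //; apply: idealD.
      have Ms' : M s' by case/MM: M3'.
      split=> //; have /MM[] // : M (r' * s).
      by rewrite -(addrK (s' * r) (r' * s)); apply: idealB => //; exact: idealM.
    have Mr' : M r' by case/MM: M2'.
    split=> //; have /MM[] // : M (s' * r).
    rewrite -(addKr (r' * s) (s' * r)) addrC; apply: idealB => //.
    by rewrite mulrC; exact: idealM.
  by exists (r' + s'), r', s'; split=> //; split=> //; exact: idealD.
(* Only [a l] survives modulo [N], so [u] and [v] are both multiples of it there, against their
   independence. *)
pose K := [set z | exists c n, N n /\ z = c * a l + n].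
have IK : I `<=` K.
  apply: IE => [|k].
    apply/is_idealP; split.
      by exists 0, 0; split; [exact: ideal0|rewrite mul0r addr0].
    move=> b _ _ [c [n [Nn ->]]] [c' [n' [Nn' ->]]].
    exists (b * c + c'), (b * n + n'); split; last by ring.
    by apply: idealD => //; apply: idealM.
  have [->|kl] := pselect (k = l).
    by exists 1, 0; rewrite mul1r addr0; split=> //; exact: ideal0.
  by exists 0, (a k); rewrite mul0r add0r; split=> //; exact: others.
have [c [n [Nn un]]] := IK _ Iu; have [d [m [Nm vm]]] := IK _ Iv.
have /coefN[_ cr cs] :
    N ((1 - c * (r + s)) * x1 + (1 - c * r) * x2 + (- (c * s)) * x3).
  suff -> : (1 - c * (r + s)) * x1 + (1 - c * r) * x2 + (- (c * s)) * x3 = n by [].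
  have -> : n = u - c * a l by rewrite un; ring.
  by rewrite al /u; ring.
have /coefN[_ dr ds] :
    N ((1 - d * (r + s)) * x1 + (- (d * r)) * x2 + (1 - d * s) * x3).
  suff -> : (1 - d * (r + s)) * x1 + (- (d * r)) * x2 + (1 - d * s) * x3 = m by [].
  have -> : m = v - d * a l by rewrite vm; ring.
  by rewrite al /v; ring.
apply: M1.
(* Modulo [M], [c * r] and [d * s] are 1 while [c * s] and [d * r] are 0, yet both pairs have the
   same product. *)
have -> : 1 =
    (1 - c * r) + (c * r) * (1 - d * s) + (- (d * r)) * (- (c * s)) by ring.
by apply: idealD => //; [apply: idealD => //|]; exact: idealM.
Qed.

(** * Simple summands and the decomposition of the maximal ideal *)

(** Simplicity makes [R (w * w)] zero or all of [Rw]. In the second case [w] is a multiple of itself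
    by an element of [M], and Nakayama gives [w = 0]. *)
Lemma simple_generator_sq0 (R : comNzRingType) (M : set R) (w : R) :
  is_local M -> M w -> is_simple (principal w) -> w * w = 0.
Proof.
move=> hM Mw [wI w0 wmin].
have [||E|E] := wmin (principal (w * w)); first exact: principal_ideal.
- by apply: principal_sub => //; exact: principalM.
- by have := mem_principal _ (w * w); rewrite E.
- have [r _ rw] : principal (w * w) w by rewrite E; exact: mem_principal.
  have w00 : w = 0.
    apply: (nakayama_cyclic _ _ (r * w) _ hM); last by rewrite -mulrA.
    by apply: idealM => //; exact: maximal_ideal.
  by rewrite w00 mulr0.
Qed.

(** A nonzero multiple [r * w] has [r] outside [M]; then [r] is a unit and [r * w] generates
    [Rw]. *)
Lemma simple_principal (R : comNzRingType) (M : set R) (w : R) :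
  is_local M -> w <> 0 -> (forall m, M m -> m * w = 0) ->
  is_simple (principal w).
Proof.
move=> hM w0 Mw0; split; first exact: principal_ideal.
  by move=> E; apply: w0; have := mem_principal _ w; rewrite E.
move=> J hJ Jw.
have [[r Jrw rw0]|J0] := pselect (exists2 r, J (r * w) & r * w <> 0).
  right; apply/seteqP; split=> //; apply: principal_sub => //.
  have [|s sr] := not_mem_maximal_unit _ _ r hM; first by move/Mw0.
  by rewrite -[w]mul1r -sr -mulrA; apply: idealM.
left; apply/seteqP; split=> [z Jz|_ ->]; last exact: ideal0.
have [r _ rz] := Jw _ Jz; apply: contrapT => z0; apply: J0.
by exists r; rewrite rz.
Qed.

(** Serves to discard zero summands and to insert new ones. The value [None] of [g] stands for a
    zero summand and may be repeated, hence injectivity only where [g] returns [Some]. *)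
Lemma direct_sum_reindex (R : comNzRingType) (L L' : Type) (I : set R)
    (a : L -> R) (g : L' -> option L) :
  (forall i j l, g i = Some l -> g j = Some l -> i = j) ->
  (forall l, a l <> 0 -> exists i, g i = Some l) ->
  is_direct_sum I (fun l => principal (a l)) ->
  is_direct_sum I (fun i => principal (oapp a 0 (g i))).
Proof.
move=> ginj gsurj [-> dir].
have sI T (D : set T) (b : T -> R) :
    is_ideal (ideal_sum D (fun l => principal (b l))).
  by apply: ideal_sum_ideal => l; exact: principal_ideal.
split.
  apply/seteqP; split; apply: ideal_sumS => // l _; apply: principal_sub => //.
    have [->|/gsurj[i gi]] := pselect (a l = 0); first exact: ideal0.
    by apply: (sub_ideal_sum _ _ _ _ i) => //; rewrite gi; exact: mem_principal.
  case: (g l) => [k|] /=; last exact: ideal0.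
  by apply: (sub_ideal_sum _ _ _ _ k) => //; exact: mem_principal.
move=> i; apply/seteqP; split=> [z|_ ->]; last first.
  by split; apply: ideal0 => //; exact: principal_ideal.
case gi: (g i) => [k|] /=; last by move=> [[r _ <-] _]; rewrite mulr0.
move=> [kz iz]; have : (principal (a k) `&`
    ideal_sum (~` [set k]) (fun l => principal (a l))) z; last by rewrite dir.
split=> //; apply: ideal_sumS iz => // j ji.
apply: principal_sub => //; case gj: (g j) => [l|] /=; last exact: ideal0.
apply: (sub_ideal_sum _ _ _ _ l); last exact: mem_principal.
by move=> /= lk; apply: ji; apply: (ginj _ _ k) => //; rewrite -lk.
Qed.

(** The generators with nonzero square, at most two, become [x] and [y], and the nonzero ones with
    square zero become the family [w]. Zero generators are dropped because a simple module is
    nonzero. *)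
Lemma maximal_decomposition (R : comNzRingType) (M : set R)
  (hM : is_local M)
  (hR : forall I : set R, is_ideal I -> is_sum_of_cyclics I) :
  exists (L : Type) (x y : R) (w : L -> R), is_decomposition M x y w.
Proof.
have [K [a dirM]] := hR M (maximal_ideal _ _ hM).
have cM l := direct_sum_complement _ _ _ _ l dirM.
have Ma l : M (a l) by have [] := cM l.
have nosum l1 l2 l3 : l1 <> l2 -> l1 <> l3 -> l2 <> l3 ->
    a l1 * a l1 <> 0 -> a l2 * a l2 <> 0 -> a l3 * a l3 <> 0 -> False.
  move=> l12 l13 l23.
  have mul0 i j := direct_sum_mul0 _ _ _ _ i j dirM.
  apply: (no_three_nonsquarezero _ _ _ _ _ hM hR); [|exact: mul0..].
  have ind i j k r s t : i <> j -> i <> k ->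
      r * a i + s * a j + t * a k = 0 -> r * a i = 0.
    move=> ij ik E; have [NI _ _ _] := cM i; apply.
    have -> : r * a i = (- s) * a j - t * a k.
      by apply/eqP; rewrite -subr_eq0 -E; apply/eqP; ring.
    have Nm l : l <> i ->
        ideal_sum (~` [set i]) (fun l => principal (a l)) (a l).
      by move=> li; apply: (sub_ideal_sum _ _ _ _ l) => //; exact: mem_principal.
    by apply: idealB => //; apply: idealM => //; apply: Nm; exact: nesym.
  move=> r1 r2 r3 E; split.
  - exact: ind E.
  - apply: (ind l2 l1 l3 r2 r1 r3) => //; first exact: nesym.
    by rewrite -E; ring.
  - apply: (ind l3 l1 l2 r3 r1 r2); [exact: nesym..|].
    by rewrite -E; ring.
(* [None] stands for a missing generator; [x] or [y] is then zero through the default of [oapp]. *)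
have [o1 [o2 [o12 onsq osq]]] : exists o1 o2 : option K,
    [/\ forall l, o1 = Some l -> o2 = Some l -> False,
        forall l, o1 = Some l \/ o2 = Some l -> a l * a l <> 0 &
        forall l, a l * a l <> 0 -> o1 = Some l \/ o2 = Some l].
  have [[l1 l1n]|all0] := pselect (exists l, a l * a l <> 0); last first.
    exists None, None; split=> [//|l [//|//]|l ln].
    by case: all0; exists l.
  have [[l2 [l12 l2n]]|all1] :=
      pselect (exists l, l1 <> l /\ a l * a l <> 0); last first.
    exists (Some l1), None; split=> [//|l [[<-]//|//]|l ln].
    left; congr Some; apply: contrapT => l1l.
    by apply: all1; exists l.
  exists (Some l1), (Some l2); split=> [l [<-] [/esym//]|l [] [<-]//|l ln].
  apply: contrapT => /not_orP[l1l l2l].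
  by apply: (nosum l1 l2 l) => // E; [apply: l1l|apply: l2l]; rewrite E.
pose S := {l | a l <> 0 /\ a l * a l = 0}.
pose w (s : S) : R := a (sval s).
exists S, (oapp a 0 o1), (oapp a 0 o2), w; split.
  pose g (i : option (option S)) : option K :=
    match i with
    | None => o1
    | Some None => o2
    | Some (Some s) => Some (sval s)
    end.
  have -> : (fun l => principal (oapp (oapp w (oapp a 0 o2)) (oapp a 0 o1) l)) =
      (fun i => principal (oapp a 0 (g i))).
    by apply/funext => -[[s|]|].
  apply: direct_sum_reindex dirM => [i j l|l al0].
    case: i j => [[[k [k0 kk]]|]|] [[[k' [k'0 k'k']]|]|] //=.
    - move=> [kl] [k'l]; subst k k'.
      by congr (Some (Some (exist _ _ _))); exact: Prop_irrelevance.
    - by move=> [kl] h; case: (onsq l); [right|rewrite -kl].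
    - by move=> [kl] h; case: (onsq l); [left|rewrite -kl].
    - by move=> h [kl]; case: (onsq l); [right|rewrite -kl].
    - by move=> h h'; case: (o12 l).
    - by move=> h [kl]; case: (onsq l); [left|rewrite -kl].
    - by move=> h h'; case: (o12 l).
  have [all|/osq[]] := pselect (a l * a l = 0).
  - by exists (Some (Some (exist _ l (conj al0 all)))).
  - by exists None.
  - by exists (Some None).
(* [M] kills [a l]: its square is zero, and so is its product with any element of the complement. *)
move=> [l [al0 all]]; apply: (simple_principal _ _ _ hM) => // m Mm.
have [NI _ _ MlN lN0] := cM l; have [r [n [Nn ->]]] := MlN _ Mm.
have nl : n * a l = 0 by apply: lN0; rewrite mulrC; exact: idealM.
by rewrite /w /= mulrDl -mulrA all mulr0 nl addr0.
Qed.

(** * Prime ideals read off from a decomposition *)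

(** Each [partial_sum] is the sum over all indices but one, [None] for [x] or [Some None] for [y],
    up to relabelling. *)
Lemma decomposition_complements (R : comNzRingType) (L : Type) (M : set R)
    (x y : R) (w : L -> R) :
  is_decomposition M x y w ->
  is_complement M x (partial_sum y w) /\ is_complement M y (partial_sum x w).
Proof.
move=> [dirM _].
pose a := oapp (oapp w y) x.
have sI T (D : set T) (b : T -> R) :
    is_ideal (ideal_sum D (fun l => principal (b l))).
  by apply: ideal_sum_ideal => l; exact: principal_ideal.
have -> : partial_sum y w =
    ideal_sum (~` [set None]) (fun l => principal (a l)).
  apply/seteqP; split; apply: ideal_sumS; do ?exact: sI.
    by move=> l _; apply: (sub_ideal_sum _ _ _ _ (Some l)).
  by move=> [l|] nl; [apply: (sub_ideal_sum _ _ _ _ l)|case: nl].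
have -> : partial_sum x w =
    ideal_sum (~` [set Some None]) (fun l => principal (a l)).
  apply/seteqP; split; apply: ideal_sumS; do ?exact: sI.
    move=> [l|] _; first by apply: (sub_ideal_sum _ _ _ _ (Some (Some l))) => -[].
    by apply: (sub_ideal_sum _ _ _ _ None).
  move=> [[l|]|] nl; last by apply: (sub_ideal_sum _ _ _ _ None).
    by apply: (sub_ideal_sum _ _ _ _ (Some l)).
  by case: nl.
split; first exact: (direct_sum_complement _ _ _ _ None dirM).
exact: (direct_sum_complement _ _ _ _ (Some None) dirM).
Qed.

(** A prime containing [x] and [y] contains all of [M], since the [w l] have square zero. The
    omitted generator is recorded for the bound on chains and for excluding nilpotent generators. *)
Lemma decomposition_prime_cases (R : comNzRingType) (M : set R)
  (hM : is_local M)
  (hR : forall I : set R, is_ideal I -> is_sum_of_cyclics I)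
  (L : Type) (x y : R) (w : L -> R) (P : set R) :
  is_decomposition M x y w -> is_prime P ->
  [\/ P = M, ~ P x /\ P = partial_sum y w | ~ P y /\ P = partial_sum x w].
Proof.
move=> dec Pp; have [cx cy] := decomposition_complements _ _ _ _ _ _ dec.
have [Px|Px] := pselect (P x); last first.
  by apply: Or32; split=> //; apply: prime_eq_complement cx Pp Px.
have [Py|Py] := pselect (P y); last first.
  by apply: Or33; split=> //; apply: prime_eq_complement cy Pp Py.
apply: Or31; apply/seteqP; split; first exact: prime_sub_maximal.
have [PI _ _] := (is_primeP _ _).1 Pp.
case: dec => -[ME _] wsimple; rewrite [in X in X `<=` _]ME.
apply: ideal_sumS => // -[[l|]|] _ /=; apply: principal_sub => //.
apply: (prime_nilpotent _ _ _ Pp); exists 2%N; rewrite expr2.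
apply: (simple_generator_sq0 _ _ _ hM) => //; rewrite ME.
by apply: (sub_ideal_sum _ _ _ _ (Some (Some l))) => //; exact: mem_principal.
Qed.

(** * Dimension, number and list of the primes *)

Theorem theorem3p1 (R : comNzRingType) (M : set R)
  (hM : is_local M)
  (hR : forall I : set R, is_ideal I -> is_sum_of_cyclics I) :
  [/\ krull_dim_le R 1,
      Spec R #<= `I_3,
      (exists (L : Type) (x y : R) (w : L -> R), is_decomposition M x y w),
      (* (b) *)
      (forall z : R, M = principal z -> ~ Nilrad R z ->
         Spec R = [set [set 0]; M]) &
      forall (L : Type) (x y : R) (w : L -> R), is_decomposition M x y w ->
      [/\ (* (a) *)
          (Nilrad R x -> Nilrad R y -> Spec R = [set M]),
          (* (c) *)
          ((forall z : R, M <> principal z) -> ~ Nilrad R x -> Nilrad R y ->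
             Spec R = [set M; partial_sum y w]),
          (* (d) *)
          ((forall z : R, M <> principal z) -> Nilrad R x -> ~ Nilrad R y ->
             Spec R = [set M; partial_sum x w]) &
          (* (e) *)
          ((forall z : R, M <> principal z) -> ~ Nilrad R x -> ~ Nilrad R y ->
             Spec R = [set M; partial_sum x w; partial_sum y w])]].
Proof.
have Mp := maximal_prime _ _ hM.
have [L0 [x0 [y0 [w0 dec0]]]] := maximal_decomposition _ _ hM hR.
have [cx0 cy0] := decomposition_complements _ _ _ _ _ _ dec0.
have cases0 P := decomposition_prime_cases _ _ hM hR _ _ _ _ P dec0.
split.
- move=> [|[|k]] P Pp PS //; exfalso.
  have Pp0 : is_prime (P 0%N) by exact: Pp.
  have [P01 nP10] := PS 0%N isT; have [P12 nP21] := PS 1%N isT.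
  (* If the middle prime of a chain of three omits a generator [z], so does the smallest, and both
     equal the complement of [z]. *)
  have absurd z N : is_complement M z N -> ~ P 1%N z -> P 1%N = N -> False.
    move=> cN P1z P1N; apply: nP10; rewrite P1N.
    rewrite -(prime_eq_complement _ _ hM hR _ _ _ cN Pp0) //.
    by move=> /P01.
  case: (cases0 _ (Pp 1%N isT)) => [P1M|[P1x P1E]|[P1y P1E]].
  - by apply: nP21; rewrite P1M; apply: prime_sub_maximal => //; exact: Pp.
  - exact: absurd cx0 P1x P1E.
  - exact: absurd cy0 P1y P1E.
(* The three candidates may coincide or fail to be prime, so [f] gives only an upper bound. *)
- pose f n := match n with
    | 0%N => M | 1%N => partial_sum y0 w0 | _ => partial_sum x0 w0 end.
  apply: card_le_trans (card_image_le f `I_3); apply: subset_card_le.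
  by move=> P /cases0[->|[_ ->]|[_ ->]]; [exists 0%N|exists 1%N|exists 2%N].
- by exists L0, x0, y0, w0.
- move=> z Mz znil.
  (* A principal [M] is the case of a zero complement. *)
  have cz : is_complement M z [set 0].
    split=> //.
    - exact: ideal_set0.
    - by rewrite Mz; exact: mem_principal.
    - by move=> _ ->; apply: ideal0; exact: maximal_ideal.
    - by move=> m; rewrite Mz => -[r _ <-]; exists r, 0; rewrite addr0.
  apply/seteqP; split=> [P Pp|P [->|->]//]; last exact: complement_prime cz znil.
  have [Pz|Pz] := pselect (P z); last first.
    by left; apply: prime_eq_complement cz Pp Pz.
  right; apply/seteqP; split; first exact: prime_sub_maximal.
  by rewrite Mz; apply: principal_sub => //; have /is_primeP[] := Pp.
move=> L x y w dec.
have [cx cy] := decomposition_complements _ _ _ _ _ _ dec.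
have cases P := decomposition_prime_cases _ _ hM hR _ _ _ _ P dec.
have Nxp : ~ Nilrad R x -> is_prime (partial_sum y w).
  exact: complement_prime cx.
have Nyp : ~ Nilrad R y -> is_prime (partial_sum x w).
  exact: complement_prime cy.
(* A nilpotent generator lies in every prime, which rules out the alternative where it is
   omitted. *)
have nil z P : Nilrad R z -> is_prime P -> P z.
  by move=> ? ?; exact: prime_nilpotent.
split.
- move=> xnil ynil; apply/seteqP; split=> [P Pp|P ->//].
  by case: (cases P Pp) => [//|[[]]|[[]]]; exact: nil.
- move=> _ xnil ynil; apply/seteqP; split=> [P Pp|P [->|->]//]; last exact: Nxp.
  by case: (cases P Pp) => [|[_]|[[]]]; [left|right|exact: nil].
- move=> _ xnil ynil; apply/seteqP; split=> [P Pp|P [->|->]//]; last exact: Nyp.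
  by case: (cases P Pp) => [|[[]]|[_]]; [left|exact: nil|right].
- move=> _ xnil ynil; apply/seteqP; split=> [P Pp|P [[->|->]|->]//].
  + by case: (cases P Pp) => [|[_]|[_]]; [left; left|right|left; right].
  + exact: Nyp.
  + exact: Nxp.
Qed.
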